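(* Let $R$ be a ring and $n\geq 1$ an integer. If the ring $T_n(R)$ of all $n\times n$ upper triangular matrices over $R$ is $\delta$-reversible, then $R$ is $\delta$-reversible.
   Context: All rings are associative with identity. A submodule $N$ of a right module $M$ is $\delta$-small in $M$ if whenever $M=N+L$ with $M/L$ singular, then $M=L$. The Zhou radical $\delta(R)$ of a ring $R$ is the sum of all $\delta$-small right ideals of $R$; equivalently, $\delta(R)$ is the intersection of all essential maximal right ideals of $R$ (with $\delta(R)=R$ if there are none). It is a two-sided ideal of $R$. A ring $R$ is $\delta$-reversible if for all $a,b\in R$, $ab=0$ implies $ba\in\delta(R)$. *)

(* Defs.v *)
From HB Require Import structures.
From mathcomp Require Import all_boot all_order all_algebra.
From mathcomp Require Import boolp classical_sets.

Set Implicit Arguments.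
Unset Strict Implicit.
Unset Printing Implicit Defensive.

Import GRing.Theory.
Local Open Scope classical_set_scope.
Local Open Scope ring_scope.

(* [lmodType S] is the type of LEFT S-modules.  A right R-module is a left
   module over the converse ring R^c, the scalar action r *: m standing for
   m r; the right module R_R is (R^c)^o, where r *: x is x * r computed in R. *)
Section Modules.
Context {S : pzRingType}.

Definition submodule (M : lmodType S) (N : set M) : Prop :=
  N 0 /\ forall (a : S) (x y : M), N x -> N y -> N (a *: x + y).

Definition essential (M : lmodType S) (N : set M) : Prop :=
  submodule N /\
  forall K : set M, submodule K -> N `&` K = [set 0] -> K = [set 0].

Definition annihilator (M : lmodType S) (m : M) : set S^o :=
  [set r : S^o | (r : S) *: m = 0].

Definition singular (M : lmodType S) : Prop :=
  forall m : M, essential (annihilator m).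

(* The annihilator of the coset m + L in the quotient module M / L. *)
Definition coset_annihilator (M : lmodType S) (L : set M) (m : M) : set S^o :=
  [set r : S^o | L ((r : S) *: m)].

Definition singular_quotient (M : lmodType S) (L : set M) : Prop :=
  forall m : M, essential (coset_annihilator L m).

(* Any module Q realising M / L is singular iff [singular_quotient L]. *)
Lemma singular_quotientP (M Q : lmodType S) (L : set M) (p : {linear M -> Q}) :
  (forall q, exists m, p m = q) -> (forall m, L m <-> p m = 0) ->
  singular_quotient L <-> singular Q.
Proof.
move=> p_surj kerp.
have annE m : coset_annihilator L m = annihilator (p m).
  by apply/funext => r; apply/propext; rewrite /annihilator /= -linearZ; exact: kerp.
split=> [sL q | sQ m]; last by rewrite annE; exact: sQ.
by have [m <-] := p_surj q; rewrite -annE; exact: sL.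
Qed.

Definition submodule_add (M : lmodType S) (N L : set M) : set M :=
  [set z | exists x y, [/\ N x, L y & z = x + y]].

Definition delta_small (M : lmodType S) (N : set M) : Prop :=
  submodule N /\
  forall L : set M, submodule L -> submodule_add N L = setT ->
    singular_quotient L -> L = setT.

Definition submodule_sum (M : lmodType S) (F : set (set M)) : set M :=
  [set z | exists2 s : seq M,
     (forall x, x \in s -> exists2 N, F N & N x) & z = \sum_(x <- s) x].

End Modules.

Definition delta_radical (R : pzRingType) : set R :=
  submodule_sum [set N : set (R^c)^o | delta_small N].

Definition delta_reversible (R : pzRingType) : Prop :=
  forall a b : R, a * b = 0 -> delta_radical (b * a).

Section UpperTriangular.
Context {R : pzRingType} {n : nat}.

(* MathComp's [is_trig_mx] is LOWER triangularity. *)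
Definition upper_trig_mx : {pred 'M[R]_n} :=
  [pred A : 'M[R]_n | [forall i : 'I_n, forall j : 'I_n, (j < i)%N ==> (A i j == 0)]].

Lemma upper_trig_mxP (A : 'M[R]_n) :
  reflect (forall i j : 'I_n, (j < i)%N -> A i j = 0) (A \in upper_trig_mx).
Proof.
apply: (iffP forallP) => [tA i j ltji | tA i].
  by apply/eqP; have /forallP/(_ j) := tA i; rewrite ltji.
by apply/forallP => j; apply/implyP => ltji; apply/eqP/tA.
Qed.

Fact upper_trig_mx_subring : subring_closed upper_trig_mx.
Proof.
split=> [|A B /upper_trig_mxP tA /upper_trig_mxP tB
         |A B /upper_trig_mxP tA /upper_trig_mxP tB];
  apply/upper_trig_mxP => i j ltji.
- rewrite [LHS]mxE; case: eqP => // eij.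
  by rewrite eij ltnn in ltji.
- by rewrite !mxE tA ?tB ?subr0.
rewrite mxE big1 // => k _.
have [ltki | leik] := ltnP k i; first by rewrite tA ?mul0r.
by rewrite tB ?mulr0 // (leq_trans ltji leik).
Qed.

End UpperTriangular.

Record upper_triangular (R : pzRingType) (n : nat) := UpperTriangular {
  utmx :> 'M[R]_n;
  utmxP : utmx \in upper_trig_mx
}.

HB.instance Definition _ (R : pzRingType) (n : nat) :=
  [isSub for @utmx R n].
HB.instance Definition _ (R : pzRingType) (n : nat) :=
  [Choice of upper_triangular R n by <:].
HB.instance Definition _ (R : pzRingType) (n : nat) :=
  GRing.SubChoice_isSubPzRing.Build 'M[R]_n (@upper_trig_mx R n)
    (upper_triangular R n) upper_trig_mx_subring.

(* Main.v *)
(* A surjective ring morphism f : T -> R maps delta(T) into delta(R), because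
   the preimage of an essential right ideal is essential: if K meets f^-1(E)
   trivially, then f(K) meets E trivially, so f(K) = 0 and K is contained in
   f^-1(E).  Hence delta-reversibility passes from T to R as soon as f has a
   multiplicative section preserving 0.  Here f reads off a diagonal entry and
   the section sends a to the scalar matrix a. *)
From HB Require Import structures.
Require Import Defs.
From mathcomp Require Import all_boot all_order all_algebra.
From mathcomp Require Import boolp classical_sets.

Set Implicit Arguments.
Unset Strict Implicit.
Unset Printing Implicit Defensive.

Import GRing.Theory.
Local Open Scope classical_set_scope.
Local Open Scope ring_scope.

Local Notation right_module_set R := (set (GRing.regular (GRing.converse R))).

Section SurjectiveMorphism.
Variables (T R : pzRingType) (f : {rmorphism T -> R}).
Hypothesis f_surj : forall y, exists x, f x = y.

Lemma submodule_preimage (E : right_module_set R) :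
  submodule E -> submodule (f @^-1` E : right_module_set T).
Proof.
move=> [E0 EZD]; split=> [|a x y Ex Ey]; first by rewrite /preimage /= rmorph0.
(* Over the converse ring [a *: x] unfolds to the product [x * a] in [T]; this form lets [rmorphM]
   apply. *)
have -> : (f @^-1` E) (a *: x + y) = E (f ((x : T) * a + y)) by [].
by rewrite rmorphD rmorphM; apply: (EZD (f a)).
Qed.

Lemma submodule_image (K : right_module_set T) :
  submodule K -> submodule (f @` K : right_module_set R).
Proof.
move=> [K0 KZD]; split=> [|a _ _ [x Kx <-] [y Ky <-]].
  by exists 0 => //; exact: rmorph0.
(* Closure under scalars from [R] needs a lift [b] of [a] to [T]. *)
have [b <-] := f_surj a.
exists ((x : T) * b + y); first exact: KZD b x y Kx Ky.
by rewrite rmorphD rmorphM.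
Qed.

Lemma essential_preimage (E : right_module_set R) :
  essential E -> essential (f @^-1` E : right_module_set T).
Proof.
move=> [subE essE]; split=> [|K subK EK0]; first exact: submodule_preimage.
have fK0 : f @` K = [set 0].
  apply: essE; first exact: submodule_image.
  apply/seteqP; split=> [y [Ey [x Kx fx]] | _ ->]; last first.
    by split; [exact: subE.1 | exists 0; [exact: subK.1 | exact: rmorph0]].
  have : (f @^-1` E `&` K) x by split=> //=; rewrite fx.
  by rewrite EK0 -fx => ->; exact: (rmorph0 f).
rewrite -EK0; apply/seteqP; split=> [x Kx | x []//]; split=> //=.
have : (f @` K) (f x) by exists x.
by rewrite fK0 => ->; exact: subE.1.
Qed.

(** If f(N) + L = R, then N + f^-1(L) = T, and T / f^-1(L) is singular because its coset
    annihilators are preimages of those of R / L. Smallness of N gives f^-1(L) = T, hence L = R by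
    surjectivity. *)
Lemma delta_small_image (N : right_module_set T) :
  delta_small N -> delta_small (f @` N : right_module_set R).
Proof.
move=> [subN smallN]; split=> [|L subL NL singL]; first exact: submodule_image.
have fLT : f @^-1` L = setT.
  apply: smallN; first exact: submodule_preimage.
    apply/seteqP; split=> // t _.
    have : submodule_add (f @` N : right_module_set R) L (f t) by rewrite NL.
    move=> [_ [l [[x Nx <-] Ll ft]]].
    (* From f(t) = f(x) + l it follows that f(t - x) = l lies in [L]. *)
    exists x, (t - x); split=> //; last by rewrite addrC subrK.
    by rewrite /preimage /= rmorphB ft addrC addrA addNr add0r.
  move=> m; have -> : coset_annihilator (f @^-1` L : right_module_set T) m =
      f @^-1` (coset_annihilator L (f m)).
    apply/funext => r; rewrite /coset_annihilator /preimage /=.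
    by have -> : f (r *: m) = f ((m : T) * r) by []; rewrite rmorphM.
  exact: essential_preimage (singL (f m)).
apply/seteqP; split=> // y _; have [x <-] := f_surj y.
by have : (f @^-1` L) x by rewrite fLT.
Qed.

(** An element of the radical is a finite sum of elements of delta-small right ideals, so the
    summands can be pushed along [f] one by one. *)
Lemma delta_radical_morph (x : T) : delta_radical x -> delta_radical (f x).
Proof.
move=> [s sN ->]; exists (map f s); last first.
  by rewrite big_map; exact: (rmorph_sum f).
move=> _ /mapP[y /sN[N smallN Ny] ->].
by exists (f @` N); [exact: delta_small_image | exists y].
Qed.

End SurjectiveMorphism.

Lemma delta_reversible_retract (T R : pzRingType) (f : {rmorphism T -> R})
    (g : R -> T) :
  cancel g f -> {morph g : x y / x * y} -> g 0 = 0 ->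
  delta_reversible T -> delta_reversible R.
Proof.
move=> gK gM g0 revT a b ab0.
have : delta_radical (g b * g a) by apply: revT; rewrite -gM ab0.
rewrite -gM -[in X in _ -> X](gK (b * a)).
by apply: delta_radical_morph => y; exists (g y).
Qed.

Section DiagonalEntry.
Variables (R : pzRingType) (n : nat) (i : 'I_n).

Definition diag_entry (A : upper_triangular R n) : R := utmx A i i.

Fact diag_entry_is_zmod_morphism : zmod_morphism diag_entry.
Proof. by move=> A B; rewrite /diag_entry !mxE. Qed.

(** In the sum of [A i j * B j i] over [j], triangularity of [A] kills the terms with j < i and that
    of [B] those with j > i. *)
Fact diag_entry_is_monoid_morphism : monoid_morphism diag_entry.
Proof.
split=> [|A B]; first by rewrite /diag_entry mxE eqxx.
rewrite /diag_entry mxE (bigD1 i) //= big1 ?addr0 // => j neji.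
have [ltji | leij] := ltnP j i.
  by rewrite (upper_trig_mxP _ (utmxP A)) ?mul0r.
by rewrite (upper_trig_mxP _ (utmxP B)) ?mulr0 // ltn_neqAle eq_sym neji.
Qed.

HB.instance Definition _ :=
  GRing.isZmodMorphism.Build (upper_triangular R n) R diag_entry
    diag_entry_is_zmod_morphism.
HB.instance Definition _ :=
  GRing.isMonoidMorphism.Build (upper_triangular R n) R diag_entry
    diag_entry_is_monoid_morphism.

End DiagonalEntry.

Fact scalar_mx_upper_trig (R : pzRingType) (n : nat) (a : R) :
  (a%:M : 'M[R]_n) \in upper_trig_mx.
Proof.
apply/upper_trig_mxP => i j ltji.
by rewrite mxE -val_eqE /= gtn_eqF.
Qed.

Definition scalar_utmx (R : pzRingType) (n : nat) (a : R) :=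
  UpperTriangular (scalar_mx_upper_trig n a).

Theorem corollary3p6 (R : pzRingType) (n : nat) (hn : (1 <= n)%N) :
  delta_reversible (upper_triangular R n) -> delta_reversible R.
Proof.
(* Since [hn] is also a proof of 0 < n, [Ordinal hn] is the index 0. *)
apply: (@delta_reversible_retract _ _ (diag_entry (Ordinal hn))
  (@scalar_utmx R n)).
- by move=> a; rewrite [LHS]mxE eqxx.
- by move=> a b; apply: val_inj; rewrite /= scalar_mxM.
- by apply: val_inj; rewrite /= raddf0.
Qed.
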